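(* Let $N\ge2$, $n\ge1$, $h>0$, $\tau\in\mathbb{Z}_+$, $\alpha,\beta>0$, and let $A=\begin{bmatrix}1&h\\0&1\end{bmatrix}\otimes I_n$, $B=\begin{bmatrix}h^2/2\\ h\end{bmatrix}\otimes I_n$, $K=[\alpha\ \ \beta]\otimes I_n$. Let $\mathcal{G}_c$ be a fixed undirected graph on $\{1,\dots,N\}$ with symmetric $0/1$ adjacency entries $o_{ij}a_{ij}$ ($o_{ii}a_{ii}=0$), with Laplacian $\mathcal{L}_c$ whose eigenvalues are $0=\lambda_1\le\lambda_2\le\dots\le\lambda_N$. Consider agents with states $x_{i,k}\in\mathbb{R}^{2n}$ evolving as $$x_{i,k+1}=Ax_{i,k}+Bu_{i,k}+w_{i,k},\qquad u_{i,k}=K\sum_{j=1}^N o_{ij}a_{ij}\big(\hat x_{j,k}-\hat x_{i,k}\big),$$ where $\hat x_{l,k}=A^k x_{l,0}$ for $0\le k\le\tau-1$ and $\hat x_{l,k}=A^{\,k-(\lfloor k/\tau\rfloor-1)\tau}x_{l,(\lfloor k/\tau\rfloor-1)\tau}$ for $k\ge\tau$, and $w_{i,k}=[(w^p_{i,k})^T,(w^v_{i,k})^T]^T$ is an arbitrary sequence with $\|w^p_{i,k}\|\le r_{w_p}(i)$, $\|w^v_{i,k}\|\le r_{w_v}(i)$. For $i=2,\dots,N$ set $\bar a_0(i)=\lambda_i^2\alpha^2h^4\tau^2(\tau^2-1)/12$, $\bar a_1(i)=\lambda_i\alpha h^2(\tau-2\tau^2)/2-\lambda_i\beta h\tau$,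 $\bar a_2(i)=1+\lambda_i\alpha h^2(4\tau^2-\tau)/2+\lambda_i\beta h\tau$, $\bar a_3(i)=-2$, $\bar a_4(i)=1$, and $\varphi_{1,i}=\bar a_4-|\bar a_0|$, $\varphi_{2,i}=|\bar a_0^2-\bar a_4^2|-|\bar a_0\bar a_3-\bar a_1\bar a_4|$, $\varphi_{3,i}=|(\bar a_0^2-\bar a_4^2)^2-(\bar a_0\bar a_3-\bar a_1\bar a_4)^2|-|-(\bar a_0\bar a_1-\bar a_3\bar a_4)(\bar a_0\bar a_3-\bar a_1\bar a_4)+\bar a_2(\bar a_0+\bar a_4)(\bar a_0-\bar a_4)^2|$ (all $\bar a_\cdot=\bar a_\cdot(i)$). If (i) $\mathcal{G}_c$ is connected and (ii) $\varphi_{1,i}>0,\varphi_{2,i}>0,\varphi_{3,i}>0$ for all $i\in\{2,\dots,N\}$, then for every initial condition and every admissible noise sequence, $\sup_{k\ge0}\|x_{i,k}-x_{j,k}\|<\infty$ for all $i,j$. Equivalently, writing $x_{i,k}=[(p_{i,k}-\Delta_i)^T,v_{i,k}^T]^T$ for any formation vector $(\Delta_1,\dots,\Delta_N)$, there exist finite $\delta_p,\delta_v$ with $\limsup_{k\to\infty}\|p_{i,k}-p_{j,k}-(\Delta_i-\Delta_j)\|\le\delta_p$ and $\limsup_{k\to\infty}\|v_{i,k}-v_{j,k}\|\le\delta_v$ for all $i,j$ (bounded formation stability). *)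

(* Defs.v *)
From HB Require Import structures.
From mathcomp Require Import all_boot all_order all_algebra.
From mathcomp Require Import reals.
Set Implicit Arguments. Unset Strict Implicit. Unset Printing Implicit Defensive.
Import Order.TTheory GRing.Theory Num.Theory.
Local Open Scope ring_scope.

Section Defs.
Variable R : realType.

Definition vnorm m (v : 'cV[R]_m) : R := Num.sqrt (\sum_(i < m) (v i 0) ^+ 2).

(* A = [1 h; 0 1] (x) I_n, written out as a block matrix acting on [p; v]. *)
Definition Amat (n : nat) (h : R) : 'M[R]_(n + n) :=
  block_mx 1%:M (h%:M) 0 1%:M.
Definition Bmat (n : nat) (h : R) : 'M[R]_(n + n, n) :=
  col_mx ((h ^+ 2 / 2)%:M) (h%:M).
Definition Kmat (n : nat) (alpha beta : R) : 'M[R]_(n, n + n) :=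
  row_mx (alpha%:M) (beta%:M).

(* Laplacian of the graph with 0/1 adjacency adj (= o_ij a_ij). *)
Definition laplacian (N : nat) (adj : rel 'I_N) : 'M[R]_N :=
  \matrix_(i, j) ((if i == j then (\sum_(l < N) (adj i l)%:R) else 0)
                   - (adj i j)%:R).

Definition xhat (n tau : nat) (h : R) (xl : nat -> 'cV[R]_(n + n)) (k : nat)
  : 'cV[R]_(n + n) :=
  if (k < tau)%N then (Amat n h) ^+ k *m xl 0%N
  else (Amat n h) ^+ (k - (k %/ tau - 1) * tau) *m xl ((k %/ tau - 1) * tau)%N.

Definition closed_loop (N n tau : nat) (h alpha beta : R) (adj : rel 'I_N)
  (x w : 'I_N -> nat -> 'cV[R]_(n + n)) : Prop :=
  forall (i : 'I_N) (k : nat),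
    x i k.+1 = Amat n h *m x i k
               + Bmat n h *m (Kmat n alpha beta *m
                   \sum_(j < N) (adj i j)%:R *:
                      (@xhat n tau h (x j) k - @xhat n tau h (x i) k))
               + w i k.

Definition abar0 (h alpha : R) (tau : nat) (lam : R) : R :=
  lam ^+ 2 * alpha ^+ 2 * h ^+ 4 * tau%:R ^+ 2 * (tau%:R ^+ 2 - 1) / 12.
Definition abar1 (h alpha beta : R) (tau : nat) (lam : R) : R :=
  lam * alpha * h ^+ 2 * (tau%:R - 2 * tau%:R ^+ 2) / 2 - lam * beta * h * tau%:R.
Definition abar2 (h alpha beta : R) (tau : nat) (lam : R) : R :=
  1 + lam * alpha * h ^+ 2 * (4 * tau%:R ^+ 2 - tau%:R) / 2 + lam * beta * h * tau%:R.
Definition abar3 : R := -2.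
Definition abar4 : R := 1.

Definition phi1 (h alpha : R) (tau : nat) (lam : R) : R :=
  abar4 - `|abar0 h alpha tau lam|.
Definition phi2 (h alpha beta : R) (tau : nat) (lam : R) : R :=
  let a0 := abar0 h alpha tau lam in let a1 := abar1 h alpha beta tau lam in
  let a3 := abar3 in let a4 := abar4 in
  `|a0 ^+ 2 - a4 ^+ 2| - `|a0 * a3 - a1 * a4|.
Definition phi3 (h alpha beta : R) (tau : nat) (lam : R) : R :=
  let a0 := abar0 h alpha tau lam in let a1 := abar1 h alpha beta tau lam in
  let a2 := abar2 h alpha beta tau lam in
  let a3 := abar3 in let a4 := abar4 in
  `|(a0 ^+ 2 - a4 ^+ 2) ^+ 2 - (a0 * a3 - a1 * a4) ^+ 2|
  - `|- ((a0 * a1 - a3 * a4) * (a0 * a3 - a1 * a4))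
       + a2 * (a0 + a4) * (a0 - a4) ^+ 2|.

End Defs.

(* Main.v *)
Require Import Defs.
From HB Require Import structures.
From mathcomp Require Import all_boot all_order all_algebra.
From mathcomp Require Import reals ring lra complex.
Set Implicit Arguments. Unset Strict Implicit. Unset Printing Implicit Defensive.
Import Order.TTheory GRing.Theory Num.Theory.
Local Open Scope ring_scope.

(* The disagreement x_i - x_j is the image of the stacked state under a row
   vector c with c 1 = 0, and by Cayley-Hamilton and connectivity c is
   annihilated by the product of the factors L - lambda_l, l >= 2.  Multiplying
   c by these factors one after the other gives finitely many combinations of
   the agents, each of which is a scalar mode lambda_l driven by the noise and
   by the next combination; the last one is 0.  Within a mode, the state at the
   sampling times k = m tau is driven by the two previous samples, and its
   characteristic polynomial is the quartic with coefficients abar_0..abar_4.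
   The conditions phi_1, phi_2, phi_3 > 0 are the Jury test for this quartic,
   whose remaining conditions F(1) > 0 and F(-1) > 0 hold because lambda_l > 0.
   Here lambda_l is nonnegative since L is positive semidefinite, and nonzero
   because phi_3 vanishes at lambda = 0. *)

(** * Schur stability and the Jury test *)

Definition schur (C : numDomainType) (p : {poly C}) := forall z, root p z -> `|z| < 1.

(** After squaring, the gap between the two sides is [(|z|^2 - 1) (1 - |r|^2)]. *)
Lemma disc_factor_le (C : numClosedFieldType) (z r : C) :
  1 <= `|z| -> `|r| < 1 -> `|z| * `|(z^-1)^* - r| <= `|z - r|.
Proof.
move=> z1 r1.
have z0 : z != 0 by rewrite -normr_gt0 (lt_le_trans ltr01).
rewrite -(norm_conjC z) -normrM mulrBr -rmorphM /= divff // rmorph1.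
rewrite -(@ler_pXn2r _ 2) ?nnegrE ?normr_ge0 // -subr_ge0 !normCK.
rewrite !rmorphB rmorph1 rmorphM /= conjCK.
have -> : (z - r) * (z^* - r^*) - (1 - z^* * r) * (1 - z * r^*)
        = (z * z^* - 1) * (1 - r * r^*) by ring.
rewrite -!normCK mulr_ge0 // subr_ge0.
  by rewrite exprn_ege1.
by rewrite exprn_ile1 // ltW.
Qed.

(* A real polynomial with all roots in the open unit disc dominates its reversal
   outside the disc (Blaschke product). *)
Lemma schur_reverse_le (C : numClosedFieldType) (g : {poly C}) (z : C) :
  map_poly Num.conj g = g -> schur g -> 1 <= `|z| ->
  `|z| ^+ (size g).-1 * `|g.[z^-1]| <= `|g.[z]|.
Proof.
move=> gR gS z1.
have g0 : g != 0.
  by apply/eqP=> g0; have := gS 1; rewrite g0 root0 normr1 ltxx => /(_ isT).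
have [rs gE] := closed_field_poly_normal g.
have l0 : lead_coef g != 0 by rewrite lead_coef_eq0.
have -> : (size g).-1 = size rs.
  by rewrite gE size_scale // size_prod_XsubC.
have gr r : r \in rs -> `|r| < 1.
  by move=> rrs; apply: gS; rewrite gE rootZ // root_prod_XsubC.
(* As [g] is real, [1/z] may be replaced by its conjugate, which allows a comparison factor by
   factor. *)
rewrite -[X in _ * X]norm_conjC -horner_map /= gR.
have hE x : `|g.[x]| = `|lead_coef g| * \prod_(r <- rs) `|x - r|.
  rewrite [in LHS]gE hornerZ normrM horner_prod normr_prod.
  by congr (_ * _); apply: eq_bigr => r _; rewrite hornerXsubC.
rewrite !hE mulrCA ler_wpM2l // {gE hE}.
elim: rs gr => [|r rs IH] gr; first by rewrite !big_nil expr0 mulr1.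
rewrite !big_cons /= exprS mulrACA ler_pM ?mulr_ge0 ?exprn_ge0 ?prodr_ge0 //.
  by rewrite disc_factor_le // gr ?mem_head.
by apply: IH => s srs; rewrite gr // inE srs orbT.
Qed.

(** Inverts one Schur-Cohn reduction, from [g] back to [f]. At a root [z] of [f] with [|z| >= 1] the
    two terms on the right would have equal modulus, but [|b| < |a|] and the bound on the reversal
    of [g] make the first one larger. *)
Lemma schur_step (C : numClosedFieldType) (f g : {poly C}) (kappa a b : C) :
  map_poly Num.conj g = g -> schur g -> `|b| < `|a| ->
  (forall z, z != 0 ->
     kappa * f.[z] = a * (z * g.[z]) + b * (z ^+ (size g).-1 * g.[z^-1])) ->
  schur f.
Proof.
move=> gR gS ab fE z fz; case: (real_ltP (normr_real z) (real1 C)) => // z1.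
have z0 : z != 0 by rewrite -normr_gt0 (lt_le_trans ltr01).
have gz : 0 < `|g.[z]|.
  rewrite normr_gt0; apply/negP => gz.
  by have := lt_le_trans (gS z gz) z1; rewrite ltxx.
have := fE z z0; rewrite (rootP fz) mulr0 => /esym/eqP.
rewrite addr_eq0 => /eqP /(congr1 Num.norm); rewrite normrN !normrM normrX => e.
have : `|a| * (`|z| * `|g.[z]|) <= `|b| * `|g.[z]|.
  by rewrite e ler_wpM2l // schur_reverse_le.
have ag : `|a| * `|g.[z]| <= `|a| * (`|z| * `|g.[z]|).
  by rewrite ler_wpM2l // ler_peMl.
by move=> /(le_trans ag); rewrite ler_pM2r // lt_geF.
Qed.

Lemma normc_real (R : rcfType) (x : R) :
  `|real_complex R x| = real_complex R `|x|.
Proof. by rewrite normc_def /= expr0n addr0 sqrtr_sqr. Qed.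

(** Coefficient lists make the identity in [z] explicit; the nonzero last entry of [t] makes its
    degree [(size t).-1]. *)
Lemma schur_step_real (R : rcfType) (s t : seq R) (kappa a b : R) :
  last 1 t != 0 -> schur (map_poly (real_complex R) (Poly t)) -> `|b| < `|a| ->
  (forall z : R[i], z != 0 ->
     real_complex R kappa * horner_rec (map (real_complex R) s) z =
       real_complex R a * (z * horner_rec (map (real_complex R) t) z)
     + real_complex R b * (z ^+ (size t).-1 * horner_rec (map (real_complex R) t) z^-1)) ->
  schur (map_poly (real_complex R) (Poly s)).
Proof.
move=> t0 tS ab st.
apply: (@schur_step _ _ _ (real_complex R kappa) (real_complex R a) (real_complex R b) _ tS).
- rewrite -map_poly_comp_id0 ?rmorph0 //; apply: eq_map_poly => x /=.
  by apply: conj_Creal; rewrite realE ler0c lecR real_leVge ?num_real.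
- by rewrite !normc_real ltcR.
- move=> z z0; rewrite !map_Poly !horner_Poly st //.
  by rewrite -map_Poly size_map_poly (PolyK t0).
Qed.

Lemma schur_linear (R : rcfType) (a0 a1 : R) : `|a0| < `|a1| ->
  schur (map_poly (real_complex R) (Poly [:: a0; a1])).
Proof.
move=> a01 z; rewrite map_Poly /root horner_Poly /= mul0r add0r.
rewrite addr_eq0 => /eqP /(congr1 Num.norm).
rewrite normrN normrM !normc_real => e.
have a1_gt0 : 0 < real_complex R `|a1| by rewrite ltcR (le_lt_trans _ a01).
by rewrite -(ltr_pM2l a1_gt0) mulr1 e ltcR.
Qed.

(* Schur-Cohn reductions take the quartic to the cubic [- (b3, b2, b1, b0)], the
   quadratic [(c2, c1, c0)] and the linear [(c1, c0 + c2)]; the signs at 1 and -1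
   are only needed for the stability of the last one. *)
Lemma jury_quartic (R : rcfType) (a0 a1 a2 a3 : R)
    (b0 := a0 ^+ 2 - 1) (b1 := a0 * a1 - a3) (b2 := a0 * a2 - a2)
    (b3 := a0 * a3 - a1)
    (c0 := b0 ^+ 2 - b3 ^+ 2) (c2 := b0 * b2 - b1 * b3) :
  `|a0| < 1 -> `|b3| < `|b0| -> `|c2| < `|c0| ->
  0 < 1 + a3 + a2 + a1 + a0 -> 0 < 1 - a3 + a2 - a1 + a0 ->
  schur (map_poly (real_complex R) (Poly [:: a0; a1; a2; a3; 1])).
Proof.
move=> ha hb hc fp fm.
pose c1 := b0 * b1 - b2 * b3.
have [a0l a0r] : -1 < a0 /\ a0 < 1 by apply/andP; rewrite -ltr_norml.
have b0n : b0 < 0 by rewrite /b0; nra.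
move: (hb); rewrite (ltr0_norm b0n) ltr_norml opprK => /andP[hb1 hb2].
have c0p : 0 < c0 by rewrite /c0; nra.
move: (hc); rewrite (gtr0_norm c0p) ltr_norml => /andP[hc1 hc2].
(* [c0 + c1 + c2] and [c0 - c1 + c2] are the reduced quadratic at 1 and -1; each is a positive
   factor times the quartic at the same point. *)
have hp : 0 < c0 + c1 + c2.
  have -> : c0 + c1 + c2
      = (b3 - b0) * ((1 - a0) * (1 + a3 + a2 + a1 + a0)).
    by rewrite /c0 /c1 /c2 /b0 /b1 /b2 /b3; ring.
  by rewrite !mulr_gt0 // subr_gt0.
have hm : 0 < c0 - c1 + c2.
  have -> : c0 - c1 + c2
      = (- b0 - b3) * ((1 - a0) * (1 - a3 + a2 - a1 + a0)).
    by rewrite /c0 /c1 /c2 /b0 /b1 /b2 /b3; ring.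
  by rewrite !mulr_gt0 // subr_gt0 //; lra.
have S1 : schur (map_poly (real_complex R) (Poly [:: c1; c0 + c2])).
  apply: schur_linear; rewrite [ltRHS]gtr0_norm; last by lra.
  by rewrite ltr_norml; apply/andP; split; lra.
have S2 : schur (map_poly (real_complex R) (Poly [:: c2; c1; c0])).
  apply: (@schur_step_real _ _ [:: c1; c0 + c2] (c0 + c2) c0 c2 _ S1) => //=.
    by rewrite gt_eqF //; lra.
  by move=> z z0; field.
have S3 : schur (map_poly (real_complex R) (Poly [:: - b3; - b2; - b1; - b0])).
  apply: (@schur_step_real _ _ [:: c2; c1; c0] (b0 ^+ 2 - b3 ^+ 2) (- b0) (- b3) _ S2) => /=.
  - by rewrite gt_eqF.
  - by rewrite !normrN.
  - by move=> z z0; rewrite /c0 /c1 /c2; field.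
apply: (@schur_step_real _ _ [:: - b3; - b2; - b1; - b0] (1 - a0 ^+ 2) 1 a0 _ S3) => /=.
- by rewrite oppr_eq0 lt_eqF.
- by rewrite normr1.
- by move=> z z0; rewrite /b0 /b1 /b2 /b3; field.
Qed.

(** * Bounded solutions of linear recurrences *)

Definition bounded_seq (R : numDomainType) (u : nat -> R) :=
  exists M, forall k, `|u k| <= M.

(** [p] evaluated at the shift operator: its kernel is the solution space of the recurrence with
    characteristic polynomial [p]. *)
Definition shift_op (R : nzRingType) (p : {poly R}) (u : nat -> R) (m : nat) : R :=
  \sum_(i < size p) p`_i * u (m + i)%N.

Lemma shift_opE (R : nzRingType) (p : {poly R}) u m n : (size p <= n)%N ->
  shift_op p u m = \sum_(i < n) p`_i * u (m + i)%N.
Proof.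
move=> pn; rewrite /shift_op (big_ord_widen _ (fun i => p`_i * u (m + i)%N) pn).
rewrite big_mkcond; apply: eq_bigr => i _.
by case: ltnP => // /(nth_default 0) ->; rewrite mul0r.
Qed.

Lemma shift_op_XsubC (R : nzRingType) (r : R) (q : {poly R}) u m :
  shift_op (('X - r%:P) * q) u m = shift_op q u m.+1 - r * shift_op q u m.
Proof.
rewrite (@shift_opE _ _ _ _ (size q).+1); last first.
  by rewrite (leq_trans (size_polyMleq _ _)) // size_XsubC.
under eq_bigr => i _ do rewrite mulrBl coefB coefXM coefCM mulrBl.
rewrite sumrB big_ord_recl /= mul0r add0r; congr (_ - _).
  by apply: eq_bigr => i _; rewrite /= addnS addSn.
rewrite big_ord_recr /= nth_default // mulr0 mul0r addr0 mulr_sumr.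
by apply: eq_bigr => i _; rewrite mulrA.
Qed.

Lemma bounded_seq_first_order (R : numFieldType) (r : R) (u : nat -> R) :
  `|r| < 1 -> bounded_seq (fun m => u m.+1 - r * u m) -> bounded_seq u.
Proof.
move=> r1 [M Mu].
have M0 : 0 <= M by rewrite (le_trans _ (Mu 0%N)).
have r0 : 0 < 1 - `|r| by rewrite subr_gt0.
(* This bound [B] satisfies [M + |r| B <= B], so it propagates. *)
exists (`|u 0%N| + M / (1 - `|r|)); elim=> [|k IH].
  by rewrite lerDl divr_ge0 // ltW.
have -> : u k.+1 = (u k.+1 - r * u k) + r * u k by rewrite subrK.
rewrite (le_trans (ler_normD _ _)) // normrM.
rewrite (le_trans (lerD (Mu k) (ler_wpM2l (normr_ge0 r) IH))) //.
rewrite -subr_ge0.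
have -> : `|u 0%N| + M / (1 - `|r|) - (M + `|r| * (`|u 0%N| + M / (1 - `|r|)))
  = (1 - `|r|) * `|u 0%N| by field; rewrite gt_eqF.
by rewrite mulr_ge0 // ltW.
Qed.

(** [p] splits into linear factors, and each factor is a stable first-order recurrence, inverted in
    turn. *)
Lemma bounded_seq_shift_op (C : numClosedFieldType) (p : {poly C}) (u : nat -> C) :
  schur p -> bounded_seq (shift_op p u) -> bounded_seq u.
Proof.
move=> pS.
have p0 : p != 0.
  by apply/eqP=> p0; have := pS 1; rewrite p0 root0 normr1 ltxx => /(_ isT).
have [rs pE] := closed_field_poly_normal p.
have l0 : lead_coef p != 0 by rewrite lead_coef_eq0.
have pr r : r \in rs -> `|r| < 1.
  by move=> rrs; apply: pS; rewrite pE rootZ // root_prod_XsubC.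
move=> [M Mp].
have {M Mp} : bounded_seq (shift_op (\prod_(z <- rs) ('X - z%:P)) u).
  exists (`|lead_coef p|^-1 * M) => k.
  rewrite -ler_pdivrMl ?invr_gt0 ?normr_gt0 // invrK -normrM.
  apply: le_trans (Mp k); set q := \prod_(z <- rs) _ in pE *.
  have qp : (size q <= size p)%N by rewrite pE size_scale.
  rewrite (shift_opE _ _ qp) mulr_sumr /shift_op.
  by under eq_bigr => i _ do rewrite mulrA -coefZ -pE.
elim: rs pr {pE} => [|r rs IH] pr.
  case=> M Mu; exists M => k; have := Mu k.
  by rewrite big_nil /shift_op size_poly1 big_ord1 coef1 mul1r addn0.
rewrite big_cons => bu; apply: IH => [s srs|]; first by rewrite pr // inE srs orbT.
apply: (@bounded_seq_first_order _ r); first by rewrite pr ?mem_head.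
by case: bu => M Mu; exists M => k; rewrite -shift_op_XsubC.
Qed.

Lemma bounded_seq_quartic (R : rcfType) (a0 a1 a2 a3 : R) (u : nat -> R) :
  schur (map_poly (real_complex R) (Poly [:: a0; a1; a2; a3; 1])) ->
  bounded_seq (fun m =>
    u m.+4 + a3 * u m.+3 + a2 * u m.+2 + a1 * u m.+1 + a0 * u m) ->
  bounded_seq u.
Proof.
move=> pS [M Mu].
suff [M' Mu'] : bounded_seq (fun m => real_complex R (u m)).
  by exists (complex.Re M') => k; have := Mu' k; rewrite normc_real lecE => /andP[].
apply: bounded_seq_shift_op pS _; exists (real_complex R M) => k.
rewrite (@shift_opE _ _ _ _ 5); last first.
  by rewrite (leq_trans (size_poly _ _)) // (leq_trans (size_Poly _)).
rewrite !big_ord_recr big_ord0 !coef_map !coef_Poly /= rmorph1 mul1r add0r.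
rewrite !addnS addn0 -!rmorphM -!rmorphD normc_real lecR.
by apply: le_trans (Mu k); rewrite le_eqVlt; apply/orP; left; apply/eqP; congr Num.norm; ring.
Qed.

Lemma eq_bounded_seq (R : numDomainType) (u v : nat -> R) :
  u =1 v -> bounded_seq u -> bounded_seq v.
Proof. by move=> uv [M Mu]; exists M => k; rewrite -uv. Qed.

Lemma bounded_seqD (R : numDomainType) (u v : nat -> R) :
  bounded_seq u -> bounded_seq v -> bounded_seq (fun k => u k + v k).
Proof.
move=> [M Mu] [M' Mv]; exists (M + M') => k.
by rewrite (le_trans (ler_normD _ _)) // lerD.
Qed.

Lemma bounded_seqM (R : numDomainType) (u v : nat -> R) :
  bounded_seq u -> bounded_seq v -> bounded_seq (fun k => u k * v k).
Proof. by move=> [M Mu] [M' Mv]; exists (M * M') => k; rewrite normrM ler_pM. Qed.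

Lemma bounded_seq_cst (R : numDomainType) (c : R) : bounded_seq (fun=> c).
Proof. by exists `|c|. Qed.

Lemma bounded_seqZ (R : numDomainType) (c : R) (u : nat -> R) :
  bounded_seq u -> bounded_seq (fun k => c * u k).
Proof. exact: bounded_seqM (bounded_seq_cst c). Qed.

Lemma bounded_seqN (R : numDomainType) (u : nat -> R) :
  bounded_seq u -> bounded_seq (fun k => - u k).
Proof. by move=> [M Mu]; exists M => k; rewrite normrN. Qed.

Lemma bounded_seq_comp (R : numDomainType) (f : nat -> nat) (u : nat -> R) :
  bounded_seq u -> bounded_seq (u \o f).
Proof. by move=> [M Mu]; exists M => k /=. Qed.

Lemma bounded_seq_sum (R : numDomainType) (I : Type) (r : seq I) (u : I -> nat -> R) :
  (forall i, bounded_seq (u i)) -> bounded_seq (fun k => \sum_(i <- r) u i k).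
Proof.
move=> ub; elim: r => [|i r IH].
  by exists 0 => k; rewrite big_nil normr0.
apply: eq_bounded_seq (bounded_seqD (ub i) IH) => k.
by rewrite big_cons.
Qed.

Lemma bounded_seq_tail (R : numDomainType) (n : nat) (M : R) (u : nat -> R) :
  (forall k, (n <= k)%N -> `|u k| <= M) -> bounded_seq u.
Proof.
move=> Mu; have M0 : 0 <= M by rewrite (le_trans _ (Mu n _)).
have S0 : 0 <= \sum_(i < n) `|u i| by exact: sumr_ge0.
exists (M + \sum_(i < n) `|u i|) => k; have [nk|kn] := leqP n k.
  by rewrite (le_trans (Mu _ nk)) // lerDl.
rewrite (bigD1 (Ordinal kn)) //= addrCA lerDl addr_ge0 //.
exact: sumr_ge0.
Qed.

(** * A single mode *)

(** Truncated subtraction gives 0 for [k < tau], so this one formula covers both cases of [xhat]. *)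
Definition sampled_at (tau k : nat) : nat := ((k %/ tau - 1) * tau)%N.

Section Mode.
Variables (R : realType) (h alpha beta lam : R) (tau : nat).
Variables (p v d e : nat -> R).
Hypotheses (h0 : 0 < h) (alpha0 : 0 < alpha) (beta0 : 0 < beta) (lam0 : 0 < lam).
Hypothesis (tau0 : (0 < tau)%N).

(** [K A^(k - s)] applied to the sample [(p s, v s)]: the feedback computed from the predicted
    state. *)
Let u k := let s := sampled_at tau k in
  alpha * (p s + (k - s)%:R * h * v s) + beta * v s.

Hypothesis pE : forall k, p k.+1 = p k + h * v k - h ^+ 2 / 2 * (lam * u k) + d k.
Hypothesis vE : forall k, v k.+1 = v k - h * (lam * u k) + e k.

Let P m := p (m * tau)%N.
Let V m := v (m * tau)%N.
Let t : R := tau%:R.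

(* Noise-free evolution over [l] steps of the period starting at [m.+1 * tau],
   during which the control only depends on the state at [m * tau]. *)
Let Pfree m (l : R) := P m.+1 + l * h * V m.+1
  - lam * h ^+ 2 / 2 * (l ^+ 2 * (alpha * P m + (alpha * t * h + beta) * V m)
                        + alpha * h * V m * (l * (l - 1) * (2 * l - 1) / 6)).
Let Vfree m (l : R) := V m.+1
  - lam * h * (l * (alpha * P m + (alpha * t * h + beta) * V m)
               + alpha * h * V m * (l * (l - 1) / 2)).

Lemma mode_control m l : (l < tau)%N ->
  u (m.+1 * tau + l) = alpha * (P m + (t + l%:R) * h * V m) + beta * V m.
Proof.
move=> lt; rewrite /u.
have -> : sampled_at tau (m.+1 * tau + l) = (m * tau)%N.
  by rewrite /sampled_at divnMDl // divn_small // addn0 subn1.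
by rewrite mulSn addnAC addnK natrD.
Qed.

(** A step adds at most [D] to the velocity error, and at most [D] plus [h] times the velocity error
    to the position error: hence linear and quadratic growth. *)
Lemma mode_period D : (forall k, `|d k| <= D) -> (forall k, `|e k| <= D) ->
  forall m l, (l <= tau)%N ->
    `|v (m.+1 * tau + l)%N - Vfree m l%:R| <= l%:R * D /\
    `|p (m.+1 * tau + l)%N - Pfree m l%:R| <= (l%:R + h * l%:R ^+ 2) * D.
Proof.
move=> dD eD m; have D0 : 0 <= D by rewrite (le_trans _ (dD 0%N)).
elim=> [|l IH] lt.
  rewrite addn0 /Pfree /Vfree -/(P _) -/(V _).
  by split; (rewrite [X in `|X|](_ : _ = 0) ?normr0; last by field);
    rewrite mulr_ge0 ?addr_ge0 ?mulr_ge0 ?sqr_ge0 // ltW.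
have [IHv IHp] := IH (ltnW lt).
rewrite addnS pE vE mode_control // -natr1; set L : R := l%:R in IHv IHp *.
split.
  rewrite (_ : _ - _ = (v (m.+1 * tau + l)%N - Vfree m L) + e (m.+1 * tau + l)%N).
    by rewrite (le_trans (ler_normD _ _)) // mulrDl mul1r lerD.
  by rewrite /Vfree; field.
rewrite (_ : _ - _ = (p (m.+1 * tau + l)%N - Pfree m L)
   + h * (v (m.+1 * tau + l)%N - Vfree m L) + d (m.+1 * tau + l)%N); last first.
  by rewrite /Pfree /Vfree; field.
rewrite (le_trans (ler_normD _ _)) // (le_trans (lerD (ler_normD _ _) (dD _))) //.
rewrite normrM (gtr0_norm h0).
rewrite (le_trans (lerD (lerD IHp (ler_wpM2l (ltW h0) IHv)) (lexx D))) // -subr_ge0.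
have -> : (L + 1 + h * (L + 1) ^+ 2) * D - ((L + h * L ^+ 2) * D + h * (L * D) + D)
   = h * D * (L + 1) by ring.
by rewrite !mulr_ge0 ?addr_ge0 ?ler0n // ltW.
Qed.

Let a0 := abar0 h alpha tau lam.
Let a1 := abar1 h alpha beta tau lam.
Let a2 := abar2 h alpha beta tau lam.

Lemma mode_schur :
  0 < phi1 h alpha tau lam -> 0 < phi2 h alpha beta tau lam ->
  0 < phi3 h alpha beta tau lam ->
  schur (map_poly (real_complex R) (Poly [:: a0; a1; a2; -2; 1])).
Proof.
rewrite /phi1 /phi2 /phi3 /abar4 /abar3 -/a0 -/a1 -/a2 !subr_gt0 => f1 f2 f3.
have t1 : 1 <= t by rewrite /t ler1n.
have a0_ge0 : 0 <= a0.
  rewrite /a0 /abar0 divr_ge0 ?ler0n // mulr_ge0 ?subr_ge0 ?exprn_ege1 //.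
  by rewrite !mulr_ge0 ?exprn_ge0 ?ler0n // ltW.
have la : 0 < lam * alpha * h ^+ 2 by rewrite !mulr_gt0 ?exprn_gt0.
have lb : 0 < lam * beta * h by rewrite !mulr_gt0.
apply: jury_quartic => //.
- by move: f2; rewrite expr1n mulr1.
(* [phi3 > 0] is the condition [|c2| < |c0|] of [jury_quartic], in expanded form. *)
- have eq_lt (x y x' y' : R) : x = x' -> y = y' -> `|x| < `|y| -> `|x'| < `|y'|.
    by move=> -> ->.
  by apply: eq_lt f3; ring.
(* At 1 the constants, the [beta] terms and the terms linear in [t] cancel. *)
- have -> : 1 + -2 + a2 + a1 + a0 = lam * alpha * h ^+ 2 * t ^+ 2 + a0.
    by rewrite /a1 /a2 /abar1 /abar2 -/t; field.
  by rewrite ltr_pwDl // mulr_gt0 // exprn_gt0 // (lt_le_trans ltr01).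
- have -> : 1 - -2 + a2 - a1 + a0 =
     4 + lam * alpha * h ^+ 2 * (3 * t ^+ 2 - t) + 2 * (lam * beta * h) * t + a0.
    by rewrite /a1 /a2 /abar1 /abar2 -/t; field.
  rewrite ltr_pwDl //.
  have : 0 <= lam * alpha * h ^+ 2 * (3 * t ^+ 2 - t).
    by rewrite mulr_ge0 //; [exact: ltW | nra].
  have : 0 <= 2 * (lam * beta * h) * t.
    by rewrite !mulr_ge0 // ?ltW // /t ler0n.
  by lra.
Qed.

Lemma mode_sampled_bounded :
  schur (map_poly (real_complex R) (Poly [:: a0; a1; a2; -2; 1])) ->
  bounded_seq d -> bounded_seq e -> bounded_seq P /\ bounded_seq V.
Proof.
move=> S [D1 dD1] [D2 eD2].
have dD k : `|d k| <= Num.max D1 D2 by rewrite le_max dD1.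
have eD k : `|e k| <= Num.max D1 D2 by rewrite le_max eD2 orbT.
have Q := mode_period dD eD.
(* Residuals over a full period: the samples [(P, V)] solve a second-order linear recurrence with
   this bounded forcing. *)
pose e1 m := P m.+2 - Pfree m t; pose e2 m := V m.+2 - Vfree m t.
have e1b : bounded_seq e1.
  exists ((t + h * t ^+ 2) * Num.max D1 D2) => m.
  by have [_] := Q m _ (leqnn _); rewrite -mulSnr.
have e2b : bounded_seq e2.
  by exists (t * Num.max D1 D2) => m; have [+ _] := Q m _ (leqnn _); rewrite -mulSnr.
have sb j (w : nat -> R) : bounded_seq w -> bounded_seq (fun m => w (j + m)%N).
  exact: bounded_seq_comp.
have e1s j := sb j e1 e1b; have e2s j := sb j e2 e2b.
(* The [Mij] are the entries of [\sum_(l < tau) A^(tau-1-l) B K A^(tau+l)].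
   Eliminating [V] or [P] by Cramer's rule leaves a recurrence with
   characteristic polynomial [det (z^2 - z A^tau + lam M)]. *)
pose M11 := alpha * h ^+ 2 * t ^+ 2 / 2.
pose M12 := h ^+ 2 / 2 * (t ^+ 2 * (alpha * t * h + beta)
                        + alpha * h * (t * (t - 1) * (2 * t - 1) / 6)).
pose M21 := h * alpha * t.
pose M22 := h * (t * (alpha * t * h + beta) + alpha * h * (t * (t - 1) / 2)).
split; apply: bounded_seq_quartic S _.
- apply: (@eq_bounded_seq _ (fun m => e1 (2 + m)%N + (- 1) * e1 (1 + m)%N
     + lam * M22 * e1 m + t * h * e2 (1 + m)%N + (- (lam * M12)) * e2 m)).
    move=> m; rewrite /e1 /e2 /Pfree /Vfree /M12 /M22 !add1n !add2n.
    by rewrite /a0 /a1 /a2 /abar0 /abar1 /abar2 -/t; field.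
  by repeat (exact: e1b || exact: e2b || exact: e1s || exact: e2s
    || apply: bounded_seqD || apply: bounded_seqZ).
- apply: (@eq_bounded_seq _ (fun m => e2 (2 + m)%N + (- 1) * e2 (1 + m)%N
     + lam * M11 * e2 m + (- (lam * M21)) * e1 m)).
    move=> m; rewrite /e1 /e2 /Pfree /Vfree /M11 /M21 !add1n !add2n.
    rewrite /a0 /a1 /a2 /abar0 /abar1 /abar2 -/t.
    move: (P m) (P m.+1) (P m.+2) (V m) (V m.+1) (V m.+2) (V m.+3) (V m.+4) t => *.
    by field.
  by repeat (exact: e1b || exact: e2b || exact: e1s || exact: e2s
    || apply: bounded_seqD || apply: bounded_seqZ).
Qed.

(** Between samples the state stays within a bounded distance of [Pfree] and [Vfree], which are
    polynomials in bounded samples and in the time elapsed in the period. *)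
Lemma mode_bounded :
  0 < phi1 h alpha tau lam -> 0 < phi2 h alpha beta tau lam ->
  0 < phi3 h alpha beta tau lam ->
  bounded_seq d -> bounded_seq e -> bounded_seq p /\ bounded_seq v.
Proof.
move=> f1 f2 f3 db eb.
have [Pb Vb] := mode_sampled_bounded (mode_schur f1 f2 f3) db eb.
case: db eb => D1 dD1 [D2 eD2].
have dD k : `|d k| <= Num.max D1 D2 by rewrite le_max dD1.
have eD k : `|e k| <= Num.max D1 D2 by rewrite le_max eD2 orbT.
have Q := mode_period dD eD; set D := Num.max D1 D2 in dD eD Q.
have D0 : 0 <= D by rewrite (le_trans _ (dD 0%N)).
(* For [k >= tau], the period containing [k] starts at [(q k).+1 * tau]; the finitely many earlier
   times are left to [bounded_seq_tail]. *)
pose q k := (k %/ tau).-1.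
have kE k : (tau <= k)%N -> k = ((q k).+1 * tau + k %% tau)%N.
  move=> tk; rewrite prednK; first exact: divn_eq.
  by rewrite divn_gt0.
have lb : bounded_seq (fun k => (k %% tau)%:R : R).
  by exists t => k; rewrite normr_nat ler_nat ltnW // ltn_mod.
have rb : bounded_seq (fun k => P (q k)) by exact: bounded_seq_comp.
have rb' : bounded_seq (fun k => P (q k).+1) by exact: (bounded_seq_comp (S \o q)).
have sb : bounded_seq (fun k => V (q k)) by exact: bounded_seq_comp.
have sb' : bounded_seq (fun k => V (q k).+1) by exact: (bounded_seq_comp (S \o q)).
have cst (c : R) := bounded_seq_cst c.
have Pfb : bounded_seq (fun k => Pfree (q k) (k %% tau)%:R).
  rewrite /Pfree.
  by repeat (assumption || exact: cst || apply: bounded_seqD || apply: bounded_seqN || apply: bounded_seqM).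
have Vfb : bounded_seq (fun k => Vfree (q k) (k %% tau)%:R).
  rewrite /Vfree.
  by repeat (assumption || exact: cst || apply: bounded_seqD || apply: bounded_seqN || apply: bounded_seqM).
have [[MP PfM] [MV VfM]] := (Pfb, Vfb).
have lt k : (k %% tau <= tau)%N by rewrite ltnW // ltn_mod.
have lR k : (k %% tau)%:R <= t by rewrite ler_nat.
split.
  apply: (@bounded_seq_tail _ tau ((t + h * t ^+ 2) * D + MP)) => k tk.
  have [_] := Q (q k) _ (lt k); rewrite -kE // => Qk.
  rewrite -(subrK (Pfree (q k) (k %% tau)%:R) (p k)).
  rewrite (le_trans (ler_normD _ _)) // lerD // (le_trans Qk) //.
  rewrite ler_wpM2r // lerD // ler_wpM2l ?(ltW h0) //.
  rewrite ler_pXn2r ?nnegrE ?ler0n //.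
apply: (@bounded_seq_tail _ tau (t * D + MV)) => k tk.
have [+ _] := Q (q k) _ (lt k); rewrite -kE // => Qk.
rewrite -(subrK (Vfree (q k) (k %% tau)%:R) (v k)).
by rewrite (le_trans (ler_normD _ _)) // lerD // (le_trans Qk) // ler_wpM2r.
Qed.
End Mode.

(** * Decoupling the agents *)

Definition rdot (R : pzRingType) N (c : 'rV[R]_N) (f : 'I_N -> R) : R :=
  \sum_i c 0 i * f i.

Lemma rdot_linear (R : comPzRingType) N (c : 'rV[R]_N) (f g : 'I_N -> R) a :
  rdot c (fun i => f i + a * g i) = rdot c f + a * rdot c g.
Proof.
rewrite /rdot mulr_sumr -big_split; apply: eq_bigr => i _.
by rewrite mulrDr mulrCA.
Qed.

Lemma rdot_linear_l (R : pzRingType) N (c c' : 'rV[R]_N) (f : 'I_N -> R) a :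
  rdot (a *: c + c') f = a * rdot c f + rdot c' f.
Proof.
rewrite /rdot mulr_sumr -big_split; apply: eq_bigr => i _.
by rewrite !mxE mulrDl mulrA.
Qed.

Lemma rdot_mulmx (R : pzRingType) N (c : 'rV[R]_N) (L : 'M_N) (f : 'I_N -> R) :
  rdot (c *m L) f = rdot c (fun i => \sum_j L i j * f j).
Proof.
rewrite /rdot; under eq_bigr => j _ do rewrite mxE mulr_suml.
rewrite exchange_big; apply: eq_bigr => i _ /=.
by rewrite mulr_sumr; apply: eq_bigr => j _; rewrite mulrA.
Qed.

Lemma rdot_delta (R : pzRingType) N (i : 'I_N) (f : 'I_N -> R) :
  rdot (delta_mx 0 i) f = f i.
Proof.
rewrite /rdot (bigD1 i) //= big1 ?addr0; first by rewrite mxE !eqxx mul1r.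
by move=> j /negPf ji; rewrite mxE ji andbF mul0r.
Qed.

Lemma horner_mx_ker (R : comNzRingType) N m (A : 'M[R]_N.+1) (w : 'M_(N.+1, m)) p :
  A *m w = 0 -> horner_mx A p *m w = p.[0] *: w.
Proof.
move=> Aw; elim/poly_ind: p => [|p c _].
  by rewrite rmorph0 mul0mx horner0 scale0r.
rewrite rmorphD rmorphM /= horner_mx_X horner_mx_C mulmxDl -mulmxA Aw mulmx0.
by rewrite add0r hornerMXaddC mulr0 add0r mul_scalar_mx.
Qed.

Section Modes.
Variables (R : realType) (h alpha beta : R) (tau N : nat) (L : 'M[R]_N.+1).
Variables (p v d e : 'I_N.+1 -> nat -> R).
Hypotheses (h0 : 0 < h) (alpha0 : 0 < alpha) (beta0 : 0 < beta).
Hypothesis (tau0 : (0 < tau)%N).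

Let g (j : 'I_N.+1) k := let s := sampled_at tau k in
  alpha * (p j s + (k - s)%:R * h * v j s) + beta * v j s.

Hypothesis pE : forall i k, p i k.+1 =
  p i k + h * v i k - h ^+ 2 / 2 * (\sum_j L i j * g j k) + d i k.
Hypothesis vE : forall i k, v i k.+1 = v i k - h * (\sum_j L i j * g j k) + e i k.
Hypothesis d_bounded : forall i, bounded_seq (d i).
Hypothesis e_bounded : forall i, bounded_seq (e i).

(** The lag is at most [tau] plus the remainder of [k], so the time-varying coefficient [k - s] in
    [g] preserves boundedness. *)
Lemma sampling_lag_bounded : bounded_seq (fun k => (k - sampled_at tau k)%:R : R).
Proof.
exists (2 * tau)%:R => k; rewrite normr_nat ler_nat /sampled_at.
rewrite leq_subLR mulnBl mul1n {1}(divn_eq k tau).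
have := ltnW (ltn_pmod k tau0); set r := (k %% tau)%N; set m := (_ * tau)%N => rt.
rewrite mul2n -addnn addnA leq_add //.
by rewrite addnC -leq_subLR.
Qed.

(** [g] is linear in the samples with coefficients common to all agents, so combining agents
    commutes with sampling and prediction. *)
Let g_rdot (c : 'rV[R]_N.+1) k : let s := sampled_at tau k in
  rdot c (g^~ k) = alpha * (rdot c (p^~ s) + (k - s)%:R * h * rdot c (v^~ s))
                   + beta * rdot c (v^~ s).
Proof.
rewrite /= /g /rdot !mulr_sumr -!big_split /= mulr_sumr -big_split /=.
by apply: eq_bigr => i _; ring.
Qed.

(* With [c' = c (L - l)], the combination [c x] evolves as the scalar mode [l]
   driven by the noise and by [c' x], which is already known to be bounded:
   this peels the factors of the product off one at a time, without
   diagonalizing [L]. *)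
Lemma modes_bounded (s : seq R) (c : 'rV[R]_N.+1) :
  (forall l, l \in s -> [/\ 0 < l, 0 < phi1 h alpha tau l,
     0 < phi2 h alpha beta tau l & 0 < phi3 h alpha beta tau l]) ->
  c *m horner_mx L (\prod_(l <- s) ('X - l%:P)) = 0 ->
  bounded_seq (fun k => rdot c (p^~ k)) /\ bounded_seq (fun k => rdot c (v^~ k)).
Proof.
elim: s c => [|l s IH] c sP.
  rewrite big_nil rmorph1 mulmx1 => ->.
  by split; exists 0 => k; rewrite /rdot big1 ?normr0 // => i _; rewrite mxE mul0r.
rewrite big_cons rmorphM -mulmxE mulmxA => cs.
have [l0 f1 f2 f3] := sP l (mem_head _ _).
set c' := c *m _ in cs.
have cE : c *m L = l *: c + c'.
  rewrite /c' rmorphB /= horner_mx_X horner_mx_C mulmxBr mul_mx_scalar.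
  by rewrite addrC subrK.
have [pb vb] : bounded_seq (fun k => rdot c' (p^~ k)) /\
               bounded_seq (fun k => rdot c' (v^~ k)).
  by apply: IH => // l' ls; apply: sP; rewrite inE ls orbT.
have gb : bounded_seq (fun k => rdot c' (g^~ k)).
  apply: eq_bounded_seq (fun k => esym (g_rdot c' k)) _ => /=.
  have pb' := bounded_seq_comp (sampled_at tau) pb.
  have vb' := bounded_seq_comp (sampled_at tau) vb.
  have lb := sampling_lag_bounded; have cst (a : R) := bounded_seq_cst a.
  by repeat (exact: pb' || exact: vb' || exact: lb || exact: cst
    || apply: bounded_seqD || apply: bounded_seqM).
have rdot_bounded (f : 'I_N.+1 -> nat -> R) : (forall i, bounded_seq (f i)) ->
    bounded_seq (fun k => rdot c (f^~ k)).
  by move=> fb; apply: bounded_seq_sum => i; apply: bounded_seqZ.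
have LE k : rdot c (fun i => \sum_j L i j * g j k)
            = l * rdot c (g^~ k) + rdot c' (g^~ k).
  by rewrite -rdot_mulmx cE rdot_linear_l.
apply: (@mode_bounded _ h alpha beta l tau _ _
  (fun k => rdot c (d^~ k) + (- (h ^+ 2 / 2)) * rdot c' (g^~ k))
  (fun k => rdot c (e^~ k) + (- h) * rdot c' (g^~ k))) => //.
- move=> k; cbv zeta beta; rewrite -g_rdot.
  have -> : rdot c (p^~ k.+1) = rdot c (p^~ k) + h * rdot c (v^~ k)
      + - (h ^+ 2 / 2) * rdot c (fun i => \sum_j L i j * g j k) + 1 * rdot c (d^~ k).
    by rewrite -!rdot_linear; apply: eq_bigr => i _; rewrite pE mul1r mulNr.
  by rewrite LE; ring.
- move=> k; cbv zeta beta; rewrite -g_rdot.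
  have -> : rdot c (v^~ k.+1) = rdot c (v^~ k)
      + - h * rdot c (fun i => \sum_j L i j * g j k) + 1 * rdot c (e^~ k).
    by rewrite -!rdot_linear; apply: eq_bigr => i _; rewrite vE mul1r mulNr.
  by rewrite LE; ring.
- by apply: bounded_seqD; [exact: rdot_bounded | exact: bounded_seqZ].
- by apply: bounded_seqD; [exact: rdot_bounded | exact: bounded_seqZ].
Qed.

End Modes.

(** * Spectrum of the graph Laplacian *)

Section Laplacian.
Variables (R : realType) (N : nat) (adj : rel 'I_N).
Local Notation L := (laplacian R adj).

Lemma laplacian_mulE (f : 'I_N -> R) i :
  \sum_j L i j * f j = \sum_j (adj i j)%:R * (f i - f j).
Proof.
under eq_bigr => j _ do rewrite mxE mulrBl.
under [RHS]eq_bigr => j _ do rewrite mulrBr.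
rewrite !sumrB; congr (_ - _); rewrite [LHS](bigD1 i) //= eqxx [X in _ + X]big1 ?addr0 ?mulr_suml //.
by move=> j /negPf ji; rewrite eq_sym ji mul0r.
Qed.

Lemma laplacian_ones (m : nat) : L *m (const_mx 1 : 'M_(N, m)) = 0.
Proof.
apply/matrixP => i j; rewrite !mxE.
under eq_bigr => l _ do rewrite [const_mx _ _ _]mxE.
rewrite (laplacian_mulE (fun=> 1)).
by apply: big1 => l _; rewrite subrr mulr0.
Qed.

Hypothesis adjC : forall i j, adj i j = adj j i.

Lemma tr_laplacian : L^T = L.
Proof.
apply/matrixP => i j; rewrite !mxE adjC eq_sym.
by case: eqVneq => // ->.
Qed.

(** Add to the double sum its copy with [i] and [j] exchanged: [c_i (c_i - c_j) + c_j (c_j - c_i)]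
    is a square. *)
Lemma laplacian_quad (c : 'rV[R]_N) :
  rdot (c *m L) (c 0) = (\sum_i \sum_j (adj i j)%:R * (c 0 i - c 0 j) ^+ 2) / 2.
Proof.
apply: (mulIf (_ : 2%:R != 0)); rewrite ?pnatr_eq0 // divfK ?pnatr_eq0 //.
rewrite mulr_natr mulr2n rdot_mulmx {1}/rdot.
under eq_bigr => i _ do rewrite laplacian_mulE mulr_sumr.
rewrite {1}exchange_big /= /rdot.
under [X in _ + X]eq_bigr => i _ do rewrite laplacian_mulE mulr_sumr.
rewrite -big_split; apply: eq_bigr => i _; rewrite -big_split.
by apply: eq_bigr => j _ /=; rewrite adjC; ring.
Qed.

(** A vanishing sum of squares forces equality along every edge, hence along every path. *)
Lemma laplacian_ker : (forall i j, connect adj i j) ->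
  forall c : 'rV[R]_N, c *m L = 0 -> forall i j, c 0 i = c 0 j.
Proof.
move=> con c cL i j.
have q0 : \sum_i \sum_j (adj i j)%:R * (c 0 i - c 0 j) ^+ 2 = 0 :> R.
  have := laplacian_quad c; rewrite cL /rdot big1 => [/esym/eqP|l _].
    by rewrite mulf_eq0 invr_eq0 pnatr_eq0 orbF => /eqP.
  by rewrite mxE mul0r.
have adjE a b : adj a b -> c 0 a = c 0 b.
  move=> ab; move: q0 => /eqP; rewrite psumr_eq0; last first.
    by move=> *; apply: sumr_ge0 => *; rewrite mulr_ge0 ?sqr_ge0 ?ler0n.
  move=> /allP /(_ a (mem_index_enum _)) /=; rewrite psumr_eq0; last first.
    by move=> *; rewrite mulr_ge0 ?sqr_ge0 ?ler0n.
  move=> /allP /(_ b (mem_index_enum _)) /=.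
  by rewrite ab mul1r sqrf_eq0 subr_eq0 => /eqP.
case/connectP: (con i j) => w; elim: w i => [|a w IH] i /= => [_ -> //|].
by case/andP => /adjE -> /IH.
Qed.

End Laplacian.

(** For a left eigenvector [c], [l |c|^2] is the Laplacian quadratic form at [c], half a sum of
    squares. *)
Lemma laplacian_eigen_ge0 (R : realType) N (adj : rel 'I_N.+1) (l : R) :
  (forall i j, adj i j = adj j i) -> root (char_poly (laplacian R adj)) l -> 0 <= l.
Proof.
move=> adjC; rewrite -eigenvalue_root_char => /eigenvalueP[c cL c0].
have cc : 0 < rdot c (c 0).
  have /rV0Pn[i ci] := c0.
  rewrite /rdot (bigD1 i) //= ltr_pwDl -?expr2 ?exprn_even_gt0 //.
  by apply: sumr_ge0 => j _; rewrite -expr2 sqr_ge0.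
rewrite -(pmulr_lge0 _ cc).
have -> : l * rdot c (c 0) = rdot (c *m laplacian R adj) (c 0).
  by rewrite cL -[l *: c]addr0 rdot_linear_l {3}/rdot big1 ?addr0 // => i _; rewrite mxE mul0r.
rewrite laplacian_quad // divr_ge0 ?ler0n //.
by do 2!apply: sumr_ge0 => ? _; rewrite mulr_ge0 ?sqr_ge0 ?ler0n.
Qed.

(* This excludes a second zero eigenvalue of the Laplacian. *)
Lemma phi3_0 (R : realType) (h alpha beta : R) tau : phi3 h alpha beta tau 0 = 0.
Proof.
rewrite /phi3 /abar0 /abar1 /abar2 /abar3 /abar4.
by rewrite [X in `|X| - _](_ : _ = 1) ?[X in _ - `|X|](_ : _ = 1) ?subrr //; ring.
Qed.

(** With [Q] the product, ['X * Q] is the characteristic polynomial, so [c' = c Q(L)] satisfies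
    [c' L = 0] and is constant by connectivity. Its entries sum to 0, because [Q(L) 1 = Q(0) 1] and
    the entries of [c] sum to 0; hence it vanishes. *)
Lemma disagreement_annihilated (R : realType) N (adj : rel 'I_N.+1)
    (lam : 'I_N.+1 -> R) (i j : 'I_N.+1) :
  (forall i j, adj i j = adj j i) -> (forall i j, connect adj i j) ->
  char_poly (laplacian R adj) = \prod_(i < N.+1) ('X - (lam i)%:P) ->
  lam ord0 = 0 ->
  (delta_mx 0 i - delta_mx 0 j : 'rV_N.+1) *m
    horner_mx (laplacian R adj) (\prod_(l < N) ('X - (lam (lift ord0 l))%:P)) = 0.
Proof.
move=> adjC con charE lam0; set Q := \prod_(l < N) _; set c := _ - _.
set L := laplacian R adj; pose c' := c *m horner_mx L Q.
have c'L : c' *m L = 0.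
  have := Cayley_Hamilton L; rewrite charE big_ord_recl lam0 subr0 -/Q.
  by rewrite mulrC rmorphM /= horner_mx_X -mulmxE -mulmxA => ->; rewrite mulmx0.
have cst := laplacian_ker adjC con c'L.
have : c' *m (const_mx 1 : 'cV_N.+1) = 0.
  rewrite -mulmxA horner_mx_ker ?laplacian_ones // -scalemxAr mulmxBl.
  have row1 l : (delta_mx 0 l : 'rV_N.+1) *m (const_mx 1 : 'cV[R]_N.+1) = const_mx 1.
    by rewrite -rowE; apply/matrixP => a b; rewrite !mxE.
  by rewrite !row1 subrr scaler0.
move=> /matrixP /(_ 0 0); rewrite !mxE.
under eq_bigr => l _ do rewrite [const_mx _ _ _]mxE mulr1 (cst l ord0).
rewrite sumr_const card_ord => /eqP; rewrite mulrn_eq0 /= => /eqP c00.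
by apply/rowP => l; rewrite (cst l ord0) c00 mxE.
Qed.

(** * Coordinates of the closed loop, and boundedness of the disagreements *)

Lemma Amat_exp (R : realType) n (h : R) r :
  Amat n h ^+ r = block_mx 1%:M (r%:R * h)%:M 0 1%:M.
Proof.
elim: r => [|r IH].
  by rewrite expr0 mul0r raddf0 -[1]/(1%:M) -scalar_mx_block.
rewrite exprS IH /Amat -mulmxE mulmx_block !mul1mx !mulmx1 !mul0mx !mulmx0.
by rewrite !addr0 add0r -raddfD /= -natr1 mulrDl mul1r.
Qed.

Lemma xhatE (R : realType) n tau (h : R) (xl : nat -> 'cV_(n + n)) k :
  xhat tau h xl k =
  Amat n h ^+ (k - sampled_at tau k) *m xl (sampled_at tau k).
Proof.
rewrite /xhat; case: ifP => // kt.
by rewrite /sampled_at divn_small // mul0n subn0.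
Qed.

Lemma coord_vnorm_le (R : realType) m (y : 'cV[R]_m) q : `|y q 0| <= vnorm y.
Proof.
rewrite -sqrtr_sqr ler_wsqrtr // (bigD1 q) //= lerDl.
by apply: sumr_ge0 => *; exact: sqr_ge0.
Qed.

Lemma vnorm_bounded (R : realType) m (y : nat -> 'cV[R]_m) :
  (forall q, bounded_seq (fun k => y k q 0)) -> exists M, forall k, vnorm (y k) <= M.
Proof.
move=> yb.
have [M My] : bounded_seq (fun k => \sum_(q < m) y k q 0 ^+ 2).
  apply: bounded_seq_sum => q.
  exact: (eq_bounded_seq _ (bounded_seqM (yb q) (yb q))).
by exists (Num.sqrt M) => k; rewrite ler_wsqrtr // (le_trans (ler_norm _)).
Qed.

(** All blocks of [A], [B] and [K] are scalar matrices, so the [q]-th positions and velocities of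
    the agents form a closed system, with feedback [- L g]. *)
Lemma closed_loop_coord (R : realType) N n tau (h alpha beta : R) (adj : rel 'I_N)
    (x w : 'I_N -> nat -> 'cV[R]_(n + n)) (q : 'I_n) :
  closed_loop tau h alpha beta adj x w ->
  let p i k := x i k (lshift n q) 0 in let v i k := x i k (rshift n q) 0 in
  let g j k := let s := sampled_at tau k in
    alpha * (p j s + (k - s)%:R * h * v j s) + beta * v j s in
  forall i k,
    p i k.+1 = p i k + h * v i k
      - h ^+ 2 / 2 * (\sum_j laplacian R adj i j * g j k) + w i k (lshift n q) 0 /\
    v i k.+1 = v i k - h * (\sum_j laplacian R adj i j * g j k)
      + w i k (rshift n q) 0.
Proof.
move=> cl p v g i k.
pose u := Kmat n alpha beta *m
  \sum_(j < N) (adj i j)%:R *: (xhat tau h (x j) k - xhat tau h (x i) k).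
have Ax (r : nat) (y : 'cV[R]_(n + n)) : Amat n h ^+ r *m y =
    col_mx (usubmx y + (r%:R * h) *: dsubmx y) (dsubmx y).
  rewrite Amat_exp -{1}[y]vsubmxK mul_block_col !mul1mx mul0mx add0r.
  by rewrite mul_scalar_mx.
have uE : u q 0 = - (\sum_j laplacian R adj i j * g j k).
  rewrite laplacian_mulE -sumrN /u mulmx_sumr summxE; apply: eq_bigr => j _.
  rewrite -scalemxAr !xhatE !Ax mxE -mulrN opprB; congr (_ * _).
  rewrite opp_col_mx add_col_mx /Kmat mul_row_col !mul_scalar_mx !mxE /g /p /v.
  by ring.
have BuE : Bmat n h *m u = col_mx ((h ^+ 2 / 2) *: u) (h *: u).
  by rewrite /Bmat mul_col_mx !mul_scalar_mx.
rewrite /p /v !cl -/u BuE -(expr1 (Amat n h)) Ax mul1r.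
clearbody u.
have col_addE (a b : 'cV[R]_(n + n)) r : (a + b) r 0 = a r 0 + b r 0 by rewrite mxE.
by rewrite !col_addE !(col_mxEu, col_mxEd) !mxE uE; split; ring.
Qed.

Theorem theorem2 (R : realType) (N n : nat) (h : R) (tau : nat) (alpha beta : R)
  (adj : rel 'I_N) (lam : 'I_N -> R)
  (rwp rwv : 'I_N -> R) (x w : 'I_N -> nat -> 'cV[R]_(n + n)) :
  (2 <= N)%N -> (1 <= n)%N -> 0 < h -> (1 <= tau)%N -> 0 < alpha -> 0 < beta ->
  (* undirected simple graph *)
  (forall i j, adj i j = adj j i) -> (forall i, adj i i = false) ->
  (* lam = ordered eigenvalues (with multiplicity) of the Laplacian *)
  char_poly (laplacian R adj) = \prod_(i < N) ('X - (lam i)%:P) ->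
  (forall i j : 'I_N, (i <= j)%N -> lam i <= lam j) ->
  (* (i) connectivity *)
  (forall i j : 'I_N, connect adj i j) ->
  (* (ii) stability conditions for i = 2..N *)
  (forall i : 'I_N, (1 <= i)%N ->
     0 < phi1 h alpha tau (lam i) /\
     0 < phi2 h alpha beta tau (lam i) /\
     0 < phi3 h alpha beta tau (lam i)) ->
  (* admissible noise *)
  (forall i k, vnorm (usubmx (w i k) : 'cV[R]_n) <= rwp i /\
               vnorm (dsubmx (w i k) : 'cV[R]_n) <= rwv i) ->
  @closed_loop R N n tau h alpha beta adj x w ->
  forall i j : 'I_N, exists M : R, forall k : nat, vnorm (x i k - x j k) <= M.
Proof.
case: N adj lam rwp rwv x w => [//|N] adj lam rwp rwv x w _ _ h0 tau0 alpha0 beta0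
  adjC _ charE lam_mono con phis noise cl i j.
have lam_ge0 l : 0 <= lam l.
  apply: (laplacian_eigen_ge0 adjC).
  by rewrite charE -(big_map lam xpredT (fun a => 'X - a%:P)) root_prod_XsubC map_f ?mem_index_enum.
(* The all-ones vector makes 0 one of the [lam l]; nonnegativity and the ordering put it first. *)
have lam0 : lam ord0 = 0.
  have : root (char_poly (laplacian R adj)) 0.
    rewrite -eigenvalue_root_char; apply/eigenvalueP; exists (const_mx 1).
      rewrite scale0r; apply: trmx_inj; rewrite trmx_mul tr_laplacian // trmx_const.
      by rewrite laplacian_ones trmx0.
    by apply/eqP=> /rowP /(_ 0); rewrite !mxE => /eqP; rewrite oner_eq0.
  rewrite charE -(big_map lam xpredT (fun a => 'X - a%:P)) root_prod_XsubC.
  case/mapP => l _ l0.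
  by apply/eqP; rewrite eq_le lam_ge0 {1}l0 lam_mono.
pose s := [seq lam (lift ord0 l) | l <- index_enum 'I_N].
have sP l : l \in s -> [/\ 0 < l, 0 < phi1 h alpha tau l,
     0 < phi2 h alpha beta tau l & 0 < phi3 h alpha beta tau l].
  case/mapP => a _ ->; have [//|f1 [f2 f3]] := phis (lift ord0 a).
  split=> //; rewrite lt_neqAle lam_ge0 andbT; apply/eqP => l0.
  by move: f3; rewrite -l0 phi3_0 ltxx.
have cs := disagreement_annihilated i j adjC con charE lam0.
have noise_u a q : bounded_seq (fun k => w a k (lshift n q) 0).
  exists (rwp a) => k; have [+ _] := noise a k; apply: le_trans.
  by apply: le_trans (coord_vnorm_le _ q); rewrite mxE.
have noise_d a q : bounded_seq (fun k => w a k (rshift n q) 0).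
  exists (rwv a) => k; have [_] := noise a k; apply: le_trans.
  by apply: le_trans (coord_vnorm_le _ q); rewrite mxE.
(* Each coordinate of the difference is a position or velocity combination with
   [c = delta_i - delta_j]. *)
apply: vnorm_bounded => q'.
have diffE (f : 'I_N.+1 -> R) : rdot (delta_mx 0 i - delta_mx 0 j) f = f i - f j.
  by rewrite addrC -scaleN1r rdot_linear_l !rdot_delta mulN1r addrC.
have modes q := modes_bounded h0 alpha0 beta0 tau0
  (fun a k => (closed_loop_coord q cl a k).1) (fun a k => (closed_loop_coord q cl a k).2)
  (fun a => noise_u a q) (fun a => noise_d a q) sP.
have {}cs : (delta_mx 0 i - delta_mx 0 j : 'rV_N.+1) *m
    horner_mx (laplacian R adj) (\prod_(l <- s) ('X - l%:P)) = 0.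
  by rewrite big_map.
case: (split_ordP q') => q ->; have [pb vb] := modes _ q cs.
- by apply: eq_bounded_seq pb => k; rewrite diffE !mxE.
- by apply: eq_bounded_seq vb => k; rewrite diffE !mxE.
Qed.
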